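(* Let $n$ be a positive integer and let $A\in\{0,1\}^{n\times n}$ have at most $2n$ non-zero entries. Then $|\det(A)|\leq 2^{n/6}\cdot 3^{n/6}$. *)

(* Defs.v *)
From mathcomp Require Import all_boot.

(* Main.v *)
(** It suffices to show [(det A)^6 * 6^n <= 6^m] for a 0/1 matrix with [m] ones,
    by induction on [n].  A row or column with at most one 1 is removed by
    expansion.  Otherwise choose a maximal set [L] of pairwise disjoint rows
    with exactly two ones, project the other rows onto the orthogonal complement
    of [L] and apply Hadamard's inequality.  A row [i] outside [L] with [r]
    ones keeps squared norm at most [r - s/2], where [s] is its total overlap
    with [L].  By maximality [s >= 1] when [r = 2], and since columns have at
    least two ones the overlaps add up to at least [#|L|].  Hence each row of
    [L] can hand a factor [4/3] over to the rows outside, and the bound reduces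
    to [(4/3)^s * (r - s/2)^3 <= 6^(r-1)]. *)
Require Import Defs.
From mathcomp Require Import all_boot all_order all_algebra.
From mathcomp Require Import reals exp.
From mathcomp Require Import ring lra zify.
Set Implicit Arguments.
Unset Strict Implicit.
Unset Printing Implicit Defensive.
Import Order.TTheory GRing.Theory Num.Theory.
Local Open Scope ring_scope.

(** * Hadamard's inequality, plain and after projecting out an orthogonal set of rows *)

Lemma gram_diag (R : realFieldType) (m n : nat) (A : 'M[R]_(m, n)) (i k : 'I_m) :
  (A *m A^T) i k = \sum_j A i j * A k j.
Proof. by rewrite mxE; apply: eq_bigr => j _; rewrite mxE. Qed.

(** Induction on the number of rows. Removing from the rows of [B] their components along the first
    row [a] is a unimodular operation [T]; it makes the Gram matrix block triangular and can only
    decrease the diagonal entries of the lower block. If [a] is zero, both sides vanish. *)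
Lemma hadamard_gram (R : realFieldType) (m n : nat) (A : 'M[R]_(m, n)) :
  \det (A *m A^T) <= \prod_i (A *m A^T) i i.
Proof.
have sq_ge0 p k (B : 'M[R]_(p, k)) i : 0 <= (B *m B^T) i i.
  by rewrite gram_diag sumr_ge0 // => j _; rewrite -expr2 sqr_ge0.
elim: m A => [|m IHm] A; first by rewrite det_mx00 big_ord0.
suff gram_le (a : 'rV[R]_n) (B : 'M[R]_(m, n)) : \det (col_mx a B *m (col_mx a B)^T) <=
    \prod_i (col_mx a B *m (col_mx a B)^T) i i.
  by rewrite -[A](@vsubmxK _ 1 m n); apply: gram_le.
set q := (a *m a^T) 0 0.
have gramE : col_mx a B *m (col_mx a B)^T =
    block_mx (a *m a^T) (a *m B^T) (B *m a^T) (B *m B^T).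
  by rewrite tr_col_mx mul_col_row.
have -> : \prod_i (col_mx a B *m (col_mx a B)^T) i i =
    q * \prod_i (B *m B^T) i i.
  rewrite gramE big_split_ord /= big_ord1 block_mxEul; congr (_ * _).
  by apply: eq_bigr => i _; rewrite block_mxEdr.
have [q0|q0] := eqVneq q 0.
  suff a0 : a = 0.
    rewrite gramE q0 a0 mul0r trmx0 !mulmx0 !mul0mx.
    by rewrite det_ublock det_mx11 mxE mul0r.
  apply/rowP => j; rewrite mxE; move/eqP: q0; rewrite /q gram_diag psumr_eq0.
    by move/allP/(_ j); rewrite mem_index_enum -expr2 sqrf_eq0 => /(_ isT)/eqP.
  by move=> k _; rewrite -expr2 sqr_ge0.
have q_gt0 : 0 < q by rewrite lt_def q0 sq_ge0.
have aaT : a *m a^T = q%:M by rewrite [LHS]mx11_scalar.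
pose B' := B - q^-1 *: (B *m a^T *m a).
have B'a : B' *m a^T = 0.
  rewrite mulmxBl -scalemxAl -(mulmxA _ a) aaT mul_mx_scalar scalerA mulVf //.
  by rewrite scale1r subrr.
have B'B' : B' *m B'^T = B *m B^T - q^-1 *: ((B *m a^T) *m (B *m a^T)^T).
  rewrite {2}/B' linearB /= linearZ /= mulmxBr -scalemxAr.
  rewrite [(B *m a^T *m a)^T]trmx_mul (mulmxA B') B'a mul0mx scaler0 subr0.
  by rewrite mulmxBl -scalemxAl -!mulmxA trmx_mul trmxK.
pose T : 'M[R]_(1 + m) := block_mx 1%:M 0 (- (q^-1 *: (B *m a^T))) 1%:M.
have detT : \det T = 1 by rewrite det_lblock !det1 mulr1.
have TA : T *m col_mx a B = col_mx a B'.
  rewrite mul_block_col !mul1mx mul0mx addr0 mulNmx -scalemxAl addrC.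
  by [].
have -> : \det (col_mx a B *m (col_mx a B)^T) = q * \det (B' *m B'^T).
  transitivity (\det (col_mx a B' *m (col_mx a B')^T)).
    rewrite -TA trmx_mul -mulmxA (mulmxA (col_mx a B)) det_mulmx (det_mulmx _ T^T).
    by rewrite det_tr detT mul1r mulr1.
  by rewrite tr_col_mx mul_col_row B'a det_ublock det_mx11.
rewrite ler_pM2l //; apply: (le_trans (IHm B')).
apply: ler_prod => i _; apply/andP; split; first exact: sq_ge0.
rewrite B'B'.
rewrite [leLHS]mxE [X in _ + X]mxE [X in - X]mxE lerBlDr lerDl.
by apply: mulr_ge0; rewrite ?invr_ge0 sq_ge0.
Qed.

(** The rows in [L] are orthogonal, so left multiplication by [1 - E] subtracts from each row
    outside [L] its projection onto their span. As [E] has its support in rows outside [L] and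
    columns inside, [E] squares to zero and the determinant keeps its square. Hadamard's inequality
    then applies to the new rows. *)
Lemma hadamard_deflated (R : realFieldType) (n : nat) (A : 'M[R]_n)
    (L : {set 'I_n}) (c : R) (g := fun i k => \sum_j A i j * A k j) :
  c != 0 -> {in L, forall i, g i i = c} ->
  {in L &, forall i k, i != k -> g i k = 0} ->
  \det A ^+ 2 <=
    c ^+ #|L| * \prod_(i | i \notin L) (g i i - c^-1 * \sum_(l in L) g i l ^+ 2).
Proof.
move=> c0 gL gLL.
pose E : 'M[R]_n :=
  \matrix_(i, l) if (i \notin L) && (l \in L) then c^-1 * g i l else 0.
have EE : E *m E = 0.
  apply/matrixP => i k; rewrite !mxE big1 // => l _; rewrite !mxE.
  by case: (l \in L); rewrite ?andbF ?mul0r ?mulr0.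
(* Conjugating by the signature of L maps E to - E, so 1 - E and its inverse
   1 + E have the same determinant. *)
pose D : 'M[R]_n := diag_mx (\row_i (-1) ^+ (i \in L)).
have DD : D *m D = 1%:M.
  rewrite mulmx_diag -diag_const_mx; congr diag_mx; apply/rowP => i.
  by rewrite !mxE -signr_addb addbb.
have DED : D *m E *m D = - E.
  apply/matrixP => i k; rewrite mul_mx_diag mul_diag_mx !mxE.
  case: (i \in L) (k \in L) => -[] /=; rewrite ?(mulr0, mul0r, oppr0) //.
  by rewrite expr0 expr1 mul1r mulrN1.
have detT : \det (1%:M - E) ^+ 2 = 1.
  have E1 : \det (1%:M - E) = \det (1%:M + E).
    have <- : D *m (1%:M + E) *m D = 1%:M - E.
      by rewrite mulmxDr mulmxDl mulmx1 DD DED.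
    by rewrite !det_mulmx mulrAC -det_mulmx DD det1 mul1r.
  rewrite expr2 {2}E1 -det_mulmx mulmxDr mulmx1 mulmxBl.
  by rewrite mul1mx EE subr0 subrK det1.
have -> : \det A ^+ 2 = \det (((1%:M - E) *m A) *m ((1%:M - E) *m A)^T).
  by rewrite det_mulmx det_tr -expr2 det_mulmx exprMn detT mul1r.
apply: (le_trans (hadamard_gram _)).
rewrite (bigID (mem L)) /= le_eqVlt; apply/orP; left; apply/eqP; congr (_ * _).
  rewrite -prodr_const; apply: eq_bigr => i iL.
  rewrite gram_diag -(gL i iL); apply: eq_bigr => j _.
  suff -> : ((1%:M - E) *m A) i j = A i j by [].
  rewrite mulmxBl mul1mx !mxE big1 ?subr0 // => k _.
  by rewrite mxE iL mul0r.
apply: eq_bigr => i iL; rewrite gram_diag.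
(* [u] is the projection of row [i]: its inner product with row [i] equals its own squared norm, so
   the squared norm of the difference falls by exactly that amount. *)
pose u j := \sum_(l in L) c^-1 * g i l * A l j.
have TA j : ((1%:M - E) *m A) i j = A i j - u j.
  rewrite mulmxBl mul1mx !mxE; congr (_ - _).
  rewrite /u [RHS]big_mkcond; apply: eq_bigr => l _.
  by rewrite mxE iL /=; case: ifP; rewrite ?mul0r.
have gu k : \sum_j u j * A k j = \sum_(l in L) c^-1 * g i l * g l k.
  under eq_bigr do rewrite big_distrl.
  rewrite exchange_big /=; apply: eq_bigr => l _.
  by rewrite [RHS]big_distrr; apply: eq_bigr => j _; rewrite /= mulrA.
have uA : \sum_j u j * A i j = c^-1 * \sum_(l in L) g i l ^+ 2.
  rewrite gu big_distrr; apply: eq_bigr => l _ /=.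
  rewrite expr2 mulrA; congr (_ * _).
  by apply: eq_bigr => j _; rewrite mulrC.
have uu : \sum_j u j * u j = c^-1 * \sum_(l in L) g i l ^+ 2.
  under eq_bigr do rewrite {2}/u big_distrr.
  rewrite exchange_big /= big_distrr; apply: eq_bigr => k kL /=.
  under eq_bigr do rewrite mulrCA.
  rewrite -big_distrr /= gu (bigD1 k) //= big1 => [|l /andP[lL lk]].
    by rewrite addr0 (gL k kL) [_ * g i k * c]mulrAC mulVf // mul1r expr2 mulrA.
  by rewrite (gLL l k lL kL lk) mulr0.
rewrite (eq_bigr (fun j => (A i j - u j) * (A i j - u j))); last first.
  by move=> j _; rewrite TA.
transitivity (g i i - (\sum_j u j * A i j) *+ 2 + \sum_j u j * u j).
  rewrite -sumrMnl -sumrB -big_split; apply: eq_bigr => j _ /=; ring.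
rewrite uA uu; ring.
Qed.

(** * The numerical estimate for one row *)

Lemma exp_cube_bound (R : realFieldType) (k : nat) :
  (4 / 3) ^+ k.+4 * k.+4%:R ^+ 3 <= 6 ^+ k.+3 :> R.
Proof.
elim: k => [|k IHk]; first lra.
rewrite exprS [leRHS]exprS -[k.+4.+1%:R]natr1.
have x4 : 4 <= k.+4%:R :> R by rewrite ler_nat.
have a0 : 0 <= (4 / 3) ^+ k.+4 :> R by apply: exprn_ge0; lra.
move: (k.+4%:R) x4 ((4 / 3) ^+ k.+4) a0 (6 ^+ _) IHk => x x4 a a0 b ab.
(* For [x >= 4] the ratio of the cubes is at most 125/64, and 2 times 4/3 stays below 6. *)
have xx : (x + 1) ^+ 3 <= 2 * x ^+ 3 by nra.
have := ler_wpM2l a0 xx; nra.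
Qed.

(** From [r = 4] on, one may drop the [s/2] and raise the exponent [s] to [r]; this is too crude for
    [r = 2, 3], which are checked case by case. For [r = 2] the value [s = 0] would give 8 > 6. *)
Lemma row_factor_bound (R : realFieldType) (r s : nat) :
  (1 < r)%N -> (s <= r)%N -> (r = 2 -> 0 < s)%N ->
  (4 / 3) ^+ s * (r%:R - 2^-1 * s%:R) ^+ 3 <= 6 ^+ r.-1 :> R.
Proof.
case: r => [|[|r]] // _; case: r => [|[|r]] /= sr s_gt0.
- by case: s sr s_gt0 => [|[|[|s]]] // _ h; [move: (h erefl) | lra | lra].
- by case: s sr {s_gt0} => [|[|[|[|s]]]] // _; lra.
have sr2 : 2^-1 * s%:R <= r.+4%:R :> R.
  by rewrite ler_pdivrMl // -natrM ler_nat; lia.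
apply: le_trans (exp_cube_bound R r); apply: ler_pM.
- by apply: exprn_ge0; lra.
- by apply: exprn_ge0; rewrite subr_ge0.
- by apply: ler_weXn2l => //; lra.
apply: lerXn2r; rewrite ?nnegrE ?ler0n ?subr_ge0 //.
by rewrite gerBl mulr_ge0 // invr_ge0.
Qed.

(** * The determinant bound for 0/1 matrices with a given number of ones *)

Definition mx01 (R : realFieldType) (n : nat) (b : rel 'I_n) : 'M[R]_n :=
  \matrix_(i, j) (b i j)%:R.

Lemma dense_det_bound (R : realFieldType) (n : nat) (b : rel 'I_n) :
  (forall i, 1 < \sum_j b i j)%N -> (forall j, 1 < \sum_i b i j)%N ->
  \det (mx01 R b) ^+ 6 * 6 ^+ n <= 6 ^+ (\sum_i \sum_j b i j)%N.
Proof.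
move=> row_gt1 col_gt1.
pose dot i k := (\sum_j (b i j && b k j))%N.
have dotC i k : dot i k = dot k i by apply: eq_bigr => j _; rewrite andbC.
have dotE i : dot i i = (\sum_j b i j)%N.
  by apply: eq_bigr => j _; rewrite andbb.
have dot_gt0 i k j : b i j -> b k j -> (0 < dot i k)%N.
  by move=> bij bkj; rewrite /dot (bigD1 j) //= bij bkj.
pose P (L : {set 'I_n}) := [forall i in L, dot i i == 2%N] &&
  [forall i in L, forall k in L, (i != k) ==> (dot i k == 0%N)].
have [L /maxsetP[/andP[/forall_inP L2 /forall_inP Ldisj] Lmax]] :
    {L : {set 'I_n} | maxset P L}.
  by apply: ex_maxset; exists set0; apply/andP; split; apply/forall_inP => i;
    rewrite inE.
have dotL i : i \in L -> dot i i = 2%N by move=> /L2/eqP.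
have dotLL i k : i \in L -> k \in L -> i != k -> dot i k = 0%N.
  by move=> iL kL ik; apply/eqP; apply: (implyP (forall_inP (Ldisj i iL) k kL)).
pose s i := (\sum_(l in L) dot i l)%N.
(* The rows of [L] are disjoint, so each 1 of row [i] is shared with at most one of them. *)
have s_le i : (s i <= dot i i)%N.
  rewrite dotE /s exchange_big leq_sum // => j _.
  case: (b i j) => /=; last by rewrite big1.
  have [[l /andP[lL blj]]|noL] := altP (@existsP _ (fun l => (l \in L) && b l j)).
    rewrite (bigD1 l) //= blj big1 // => k /andP[kL kl].
    case bkj: (b k j) => //.
    by have := dot_gt0 _ _ _ bkj blj; rewrite dotLL.
  rewrite big1 // => l lL; case blj: (b l j) => //.
  by case/existsP: noL; exists l; rewrite lL blj.
(* Otherwise [i |: L] would contradict the maximality of [L]. *)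
have s_gt0 i : i \notin L -> dot i i = 2%N -> (0 < s i)%N.
  move=> iL ri; rewrite lt0n; apply/negP; rewrite sum_nat_eq0 => /forall_inP s0.
  case/negP: iL; suff <- : i |: L = L by rewrite setU11.
  apply: Lmax; last exact: subsetUr.
  apply/andP; split; apply/forall_inP => k; rewrite !inE.
    by case/predU1P => [->|/L2 //]; rewrite ri.
  case/predU1P => [->|kL]; apply/forall_inP => l; rewrite !inE.
    by case/predU1P => [->|/s0 ->]; rewrite ?eqxx ?implybT.
  case/predU1P => [->|lL]; first by rewrite dotC s0 ?implybT.
  by apply/implyP => kl; rewrite dotLL.
(* A column through a 1 of row [l] has a second 1, in a row that meets [l] and hence lies outside
   [L]. *)
have s_sum : (#|L| <= \sum_(i | i \notin L) s i)%N.
  rewrite exchange_big -sum1_card leq_sum // => l lL.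
  have [j blj] : exists j, b l j.
    apply/existsP; apply: contraTT (row_gt1 l) => /existsPn bl.
    by rewrite big1 // => j _; rewrite (negbTE (bl j)).
  have [i /andP[il bij]] : exists i, (i != l) && b i j.
    apply/existsP; apply: contraTT (col_gt1 j) => /existsPn bj.
    rewrite (bigD1 l) //= blj big1 // => i il.
    by have := bj i; rewrite il /= => /negbTE->.
  have il_gt0 := dot_gt0 _ _ _ bij blj.
  rewrite (bigD1 i) /= ?ltn_addr //.
  by apply/negP => iL; rewrite dotLL in il_gt0.
have dot_le2 i l : l \in L -> (dot i l <= 2)%N.
  by move=> lL; rewrite -(dotL _ lL) leq_sum // => j _; case: (b i j) (b l j) => -[].
have gE i k : \sum_j mx01 R b i j * mx01 R b k j = (dot i k)%:R.
  by rewrite natr_sum; apply: eq_bigr => j _; rewrite !mxE -natrM mulnb.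
have det2 : \det (mx01 R b) ^+ 2 <=
    2 ^+ #|L| * \prod_(i | i \notin L) ((dot i i)%:R - 2^-1 * (s i)%:R).
  have := @hadamard_deflated R n (mx01 R b) L 2; rewrite /= => /(_ _ _ _)/le_trans.
  apply.
  - by rewrite pnatr_eq0.
  - by move=> i iL; rewrite gE dotL.
  - by move=> i k iL kL ik; rewrite gE dotLL.
  (* An overlap [d] is 0, 1 or 2: [d ^ 2 <= 2 * d] makes the projected norms nonnegative, and
     [d <= d ^ 2] lets [s i] replace the sum of squares. *)
  rewrite ler_pM2l ?exprn_gt0 //; apply: ler_prod => i iL.
  have -> : \sum_(l in L) (\sum_j mx01 R b i j * mx01 R b l j) ^+ 2 =
      (\sum_(l in L) dot i l ^ 2)%N%:R.
    by rewrite natr_sum; apply: eq_bigr => l _; rewrite gE natrX.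
  rewrite gE; apply/andP; split.
    rewrite subr_ge0 ler_pdivrMl // -natrM ler_nat.
    apply: (@leq_trans (2 * s i)); last by rewrite leq_mul2l s_le.
    rewrite big_distrr leq_sum //= => l lL.
    by rewrite -mulnn leq_mul2r dot_le2 ?orbT.
  rewrite lerD2l lerN2 ler_pM2l ?invr_gt0 // ler_nat leq_sum // => l _.
  by case: (dot i l) => // d; rewrite -mulnn leq_pmulr.
have factor_ge0 i : 0 <= (dot i i)%:R - 2^-1 * (s i)%:R :> R.
  rewrite subr_ge0 ler_pdivrMl // -natrM ler_nat.
  by rewrite (leq_trans (s_le i)) // leq_pmull.
have det6 : \det (mx01 R b) ^+ 6 <= 8 ^+ #|L| *
    \prod_(i | i \notin L) ((dot i i)%:R - 2^-1 * (s i)%:R) ^+ 3.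
  rewrite prodrXl (_ : 8 = 2 ^+ 3); last by rewrite -natrX.
  rewrite -exprM mulnC exprM -exprMn -[6%N]/(2 * 3)%N exprM.
  apply: lerXn2r; rewrite ?nnegrE ?sqr_ge0 //.
  by rewrite mulr_ge0 ?exprn_ge0 ?prodr_ge0.
have weight : (4 / 3) ^+ #|L| <= \prod_(i | i \notin L) (4 / 3) ^+ s i :> R.
  by rewrite -expr_sum; apply: ler_weXn2l => //; lra.
have -> : 6 ^+ (\sum_i \sum_j b i j)%N = 36 ^+ #|L| *
    \prod_(i | i \notin L) (6 * 6 ^+ (dot i i).-1) :> R.
  rewrite expr_sum (bigID (mem L)) /= -prodr_const; congr (_ * _).
    by apply: eq_bigr => i iL; rewrite -dotE dotL // -natrX.
  apply: eq_bigr => i _; have ri : (0 < dot i i)%N by rewrite dotE ltnW ?row_gt1.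
  by rewrite -exprS prednK // dotE.
have -> : 6 ^+ n = 6 ^+ #|L| * \prod_(i | i \notin L) 6 :> R.
  transitivity (\prod_(i < n) 6 : R); first by rewrite prodr_const card_ord.
  by rewrite (bigID (mem L)) /= prodr_const.
rewrite big_split /= mulrA [leRHS]mulrCA [leRHS]mulrC.
apply: ler_wpM2r; first by rewrite prodr_ge0.
rewrite (_ : 36 = 6 * 6); last by rewrite -natrM.
rewrite exprMn [leRHS]mulrAC.
apply: ler_wpM2r; first exact: exprn_ge0.
apply: le_trans det6 _.
(* Once [6 ^+ n] is cancelled, a row of [L] has 8 on the left against 6 on the right; [weight]
   charges the excess 4/3 to the rows outside [L]. *)
rewrite (_ : 8 = 6 * (4 / 3)); last lra.
rewrite exprMn -mulrA; apply: ler_wpM2l; first exact: exprn_ge0.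
apply: (@le_trans _ _ (\prod_(i | i \notin L)
    ((4 / 3) ^+ s i * ((dot i i)%:R - 2^-1 * (s i)%:R) ^+ 3))).
  rewrite [leRHS]big_split /=; apply: ler_wpM2r => //.
  by apply: prodr_ge0 => i _; apply: exprn_ge0.
apply: ler_prod => i iL; apply/andP; split.
  by apply: mulr_ge0; apply: exprn_ge0 => //; lra.
by apply: row_factor_bound => //; [rewrite dotE | exact: s_gt0].
Qed.

(** Expansion along the row leaves at most one minor. Passing to it loses at least one 1, which pays
    for the extra factor 6 on the left. *)
Lemma sparse_row_det_bound (R : realFieldType) (n : nat) (b : rel 'I_n.+1)
    (i0 : 'I_n.+1) :
  (forall c : rel 'I_n,
     \det (mx01 R c) ^+ 6 * 6 ^+ n <= 6 ^+ (\sum_i \sum_j c i j)%N) ->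
  (\sum_j b i0 j <= 1)%N ->
  \det (mx01 R b) ^+ 6 * 6 ^+ n.+1 <= 6 ^+ (\sum_i \sum_j b i j)%N.
Proof.
move=> IHn row_le1; rewrite (expand_det_row _ i0).
have [j0 bj0|b0] := pickP (b i0); last first.
  by rewrite big1 ?expr0n ?mul0r ?exprn_ge0 // => j _; rewrite mxE b0 mul0r.
rewrite (bigD1 j0) //= big1 => [|j jj0]; last first.
  rewrite mxE; case bj: (b i0 j); last by rewrite mul0r.
  by move: row_le1; rewrite (bigD1 j0) //= bj0 (bigD1 j) //= bj.
pose c i j := b (lift i0 i) (lift j0 j).
rewrite addr0 mxE bj0 mul1r /cofactor exprMn.
rewrite [((-1) ^+ _) ^+ 6](exprM _ 2 3) sqrr_sign expr1n mul1r.
rewrite (_ : row' i0 (col' j0 (mx01 R b)) = mx01 R c); last first.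
  by apply/matrixP => i j; rewrite !mxE.
have count : ((\sum_i \sum_j c i j).+1 <= \sum_i \sum_j b i j)%N.
  rewrite [leqRHS](bigD1_ord i0) //= -add1n leq_add //.
    by rewrite (bigD1 j0) //= bj0.
  by apply: leq_sum => i _; rewrite [leqRHS](bigD1_ord j0) //= leq_addl.
apply: le_trans (ler_weXn2l _ count); last by rewrite ler1n.
by rewrite [6 ^+ n.+1]exprS mulrCA [leRHS]exprS ler_pM2l.
Qed.

Lemma det01_bound (R : realFieldType) (n : nat) (b : rel 'I_n) :
  \det (mx01 R b) ^+ 6 * 6 ^+ n <= 6 ^+ (\sum_i \sum_j b i j)%N.
Proof.
elim: n b => [|n IHn] b; first by rewrite det_mx00 big_ord0 expr1n mulr1.
have [/existsP[i]|/existsPn rows] := boolP [exists i, (\sum_j b i j <= 1)%N].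
  exact: sparse_row_det_bound.
have [/existsP[j]|/existsPn cols] := boolP [exists j, (\sum_i b i j <= 1)%N].
  (* A sparse column is a sparse row of the transpose, which has the same determinant and as many
     ones. *)
  move=> /(sparse_row_det_bound (b := fun i j => b j i) IHn).
  rewrite exchange_big -det_tr (_ : _^T = mx01 R b) //.
  by apply/matrixP => i k; rewrite !mxE.
by apply: dense_det_bound => k; rewrite ltnNge.
Qed.

(** * Sixth roots and the final bound *)

Lemma norm_le_root6 (R : realType) (n : nat) (d : R) :
  d ^+ 6 <= 6 ^+ n -> `|d| <= 2 `^ (n%:R / 6) * 3 `^ (n%:R / 6).
Proof.
move=> h.
have -> : `|d| = (`|d| ^+ 6) `^ 6^-1.
  rewrite -powR_mulrn // -powRrM. by rewrite mulfV ?pnatr_eq0 ?powRr1.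
rewrite -powRM // -natrM powRrM powR_mulrn //.
rewrite ge0_ler_powR ?invr_ge0 ?nnegrE ?exprn_ge0 //.
by rewrite -normrX ger0_norm // exprn_even_ge0.
Qed.

Theorem theorem3 (R : realType) (n : nat) (A : 'M[R]_n) :
  (0 < n)%N ->
  (forall i j : 'I_n, A i j = 0 \/ A i j = 1) ->
  (#|[set p : 'I_n * 'I_n | (A p.1 p.2 != 0)%R]| <= 2 * n)%N ->
  `|\det A| <= 2 `^ (n%:R / 6) * 3 `^ (n%:R / 6).
Proof.
move=> _ A01 ones; apply: norm_le_root6.
pose b i j := A i j != 0.
have -> : A = mx01 R b.
  apply/matrixP => i j; rewrite mxE /b.
  by case: (A01 i j) => ->; rewrite ?eqxx ?oner_eq0.
have le_ones : (\sum_i \sum_j b i j <= n + n)%N.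
  rewrite addnn -mul2n (leq_trans _ ones) // pair_big /= -sum1_card.
  by rewrite [leqRHS]big_mkcond leq_sum // => p _; rewrite inE /b; case: (_ != _).
(* Multiplied by [6 ^+ n], the right side becomes [6 ^+ (n + n)], which dominates 6 to the number of
   ones. *)
rewrite -(@ler_pM2r _ (6 ^+ n)) ?exprn_gt0 // -exprD.
apply: le_trans (det01_bound _ _) _.
by apply: ler_weXn2l; rewrite // ler1n.
Qed.
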